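(* Let $c\in(0,1]$ and let $X$ be a separable Banach space whose norm is $c$-Lipschitz weak-star Kadec-Klee. Then for every $\varepsilon>0$ there is a closed linear subspace $E$ of $c_0(\mathbb N)$ with $d_{BM}(X,E)\le \frac1{c^2}+\varepsilon$.
   Context: For a separable Banach space $X$ and $c\in(0,1]$, the norm of $X$ is called $c$-Lipschitz weak-star Kadec-Klee ($c$-$LKK^*$) if its dual norm satisfies: for every $x^*\in X^*$ and every weak$^*$-null sequence $(x_n^* )$ in $X^*$, $\limsup_n\|x^*+x_n^*\|\ge \|x^*\|+c\,\limsup_n\|x_n^*\|$. $d_{BM}(X,E)=\inf\{\|T\|\,\|T^{-1}\|: T:X\to E \text{ linear isomorphism onto}\}$ is the Banach-Mazur distance. *)

(* Defs.v *)
From HB Require Import structures.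
From mathcomp Require Import all_boot all_order all_algebra.
From mathcomp Require Import all_classical all_reals all_analysis.
Set Implicit Arguments. Unset Strict Implicit. Unset Printing Implicit Defensive.
Import Order.TTheory GRing.Theory Num.Theory.
Import numFieldNormedType.Exports.
Local Open Scope classical_set_scope.
Local Open Scope ring_scope.

Section Defs.
Context {R : realType}.

Definition separable (X : normedModType R) : Prop :=
  exists D : set X, countable D /\ dense D.

Definition is_linear (U V : lmodType R) (f : U -> V) : Prop :=
  forall (a : R) (x y : U), f (a *: x + y) = a *: f x + f y.

Definition is_dual (X : normedModType R) (f : X -> R) : Prop :=
  is_linear (f : X -> R^o) /\ continuous f.

Definition dual_norm (X : normedModType R) (f : X -> R) : R :=
  sup [set `|f x| | x in [set x : X | `|x| <= 1]].

Definition weakstar_null (X : normedModType R) (xs : nat -> X -> R) : Prop :=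
  (forall n, is_dual (xs n)) /\ forall x : X, (fun n => xs n x) @ \oo --> (0 : R).

Definition LKKstar (c : R) (X : normedModType R) : Prop :=
  forall (xstar : X -> R) (xs : nat -> X -> R),
    is_dual xstar -> weakstar_null xs ->
    (limn_esup (fun n => (dual_norm (fun x => xstar x + xs n x))%:E)
      >= (dual_norm xstar)%:E + c%:E * limn_esup (fun n => (dual_norm (xs n))%:E))%E.

Definition c0 : set (nat -> R) := [set u | u @ \oo --> (0 : R)].
Definition c0norm (u : nat -> R) : R := sup [set `|u n| | n in [set: nat]].

Definition closed_subspace_c0 (E : set (nat -> R)) : Prop :=
  [/\ E `<=` c0,
      E (fun _ => 0),
      (forall (a : R) u v, E u -> E v -> E (fun n => a * u n + v n)) &
      (forall u, c0 u ->
         (forall e : R, 0 < e -> exists2 v, E v & c0norm (fun n => u n - v n) < e) ->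
         E u)].

Definition opnorm_to_c0 (X : normedModType R) (T : X -> nat -> R) : \bar R :=
  ereal_sup [set (c0norm (T x))%:E | x in [set x : X | `|x| <= 1]].
Definition opnorm_inv_c0 (X : normedModType R) (T : X -> nat -> R) : \bar R :=
  ereal_sup [set (`|x|)%:E | x in [set x : X | c0norm (T x) <= 1]].

Definition iso_onto (X : normedModType R) (E : set (nat -> R))
    (T : X -> nat -> R) : Prop :=
  [/\ forall (a : R) x y, T (a *: x + y) = (fun n => a * T x n + T y n),
      injective T, range T = E,
      (opnorm_to_c0 T < +oo)%E & (opnorm_inv_c0 T < +oo)%E].

Definition dBM (X : normedModType R) (E : set (nat -> R)) : \bar R :=
  ereal_inf [set (opnorm_to_c0 T * opnorm_inv_c0 T)%E | T in @iso_onto X E].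

End Defs.

(* Main.v *)
Require Import Defs.
From HB Require Import structures.
From mathcomp Require Import all_boot all_order all_algebra.
From mathcomp Require Import all_classical all_reals all_analysis.
From mathcomp Require Import ring lra.
Import Order.TTheory GRing.Theory Num.Theory.
Import numFieldNormedType.Exports.
Local Open Scope classical_set_scope.
Local Open Scope ring_scope.

(** Let B be the unit ball of the dual and (q_l) a dense sequence of X. The
    Kadec-Klee property makes B norm separable, say with dense sequence (e_i).
    Together with weak-star compactness it also shows that for every n there is
    M_n such that each f in B has some e_i with i <= M_n, almost equal to f on
    q_0, .., q_(n-1), and such that ||e_i|| + c ||f - e_i|| is at most ||f||, up
    to a small error. Peeling an element e_i of B successively through the levels
    n, n-1, .., 0 writes it as a sum of differences e_i' - e_j' whose norms add
    up to at most ||e_i|| / c plus a small error. At each level there are finitely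
    many differences, and they are small on q_0, .., q_(n-1), so after
    normalisation they form a weak-star null sequence (F_k) in B with
    ||x|| <= (1/c + eps) sup_k |F_k x|. Hence x |-> (F_k x)_k embeds X into c0
    with distortion at most 1/c + eps <= 1/c^2 + eps. *)

(** * Hahn-Banach by minimal sublinear functionals *)

Section HahnBanach.
Context {R : realType} {V : lmodType R}.
Implicit Types (p f : V -> R) (x y z : V).

Definition sublinear p :=
  (forall x y, p (x + y) <= p x + p y) /\
  (forall (a : R) x, 0 <= a -> p (a *: x) <= a * p x).

Lemma sublinear0 p : sublinear p -> p 0 = 0.
Proof.
move=> [padd phom]; have := phom 0 0 (lexx 0); rewrite scale0r mul0r => p0.
have := padd 0 0; rewrite addr0; lra.
Qed.

Lemma sublinear_scale p a x : sublinear p -> 0 <= a -> p (a *: x) = a * p x.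
Proof.
move=> sp; rewrite le_eqVlt => /orP[/eqP <-|a0].
  by rewrite scale0r mul0r sublinear0.
apply/eqP; rewrite eq_le (sp.2 _ _ (ltW a0))/= -ler_pdivlMl//.
rewrite -[in leLHS](scalerK (lt0r_neq0 a0) x).
by apply: sp.2; rewrite invr_ge0 ltW.
Qed.

Lemma sublinear_opp_ge p x : sublinear p -> - p (- x) <= p x.
Proof.
move=> sp; have := sp.1 x (- x); rewrite subrr sublinear0//; lra.
Qed.

(* A sublinear functional below [p] that is at most [- p y] at [- y]; a minimal
   sublinear functional is therefore odd, hence linear. *)
Definition sublinear_cut p y x :=
  inf [set p (x + t *: y) - t * p y | t in [set t : R | 0 <= t]].

Lemma sublinear_cut_le p y x t : sublinear p -> 0 <= t ->
  sublinear_cut p y x <= p (x + t *: y) - t * p y.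
Proof.
move=> sp t0; apply: ge_inf; last by exists t.
exists (- p (- x)) => _ [s /= s0 <-].
have := sp.1 (x + s *: y) (- x).
rewrite addrAC subrr add0r (sublinear_scale _ _ _ sp s0); lra.
Qed.

Lemma sublinear_cut_ge p y x m :
  (forall t, 0 <= t -> m <= p (x + t *: y) - t * p y) ->
  m <= sublinear_cut p y x.
Proof.
move=> h; apply: lb_le_inf; first by eexists; exists 0 => //=.
by move=> _ [t /= t0 <-]; exact: h.
Qed.

(** Parameters [s] for [x] and [t] for [z] combine to [s + t] for [x + z], and scaling by [a] turns
    [t] into [a * t]; then pass to infima. *)
Lemma sublinear_sublinear_cut p y : sublinear p -> sublinear (sublinear_cut p y).
Proof.
move=> sp; split=> [x z|a x].
- rewrite -lerBlDr; apply: sublinear_cut_ge => s s0.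
  rewrite lerBlDr -lerBlDl; apply: sublinear_cut_ge => t t0.
  rewrite lerBlDl.
  apply: le_trans (sublinear_cut_le _ _ (x + z) _ sp (addr_ge0 s0 t0)) _.
  have := sp.1 (x + s *: y) (z + t *: y).
  rewrite addrACA -scalerDl; lra.
- rewrite le_eqVlt => /orP[/eqP <-|a0].
    rewrite scale0r mul0r; apply: le_trans (sublinear_cut_le _ _ 0 0 sp _) _ => //.
    by rewrite scale0r addr0 mul0r subr0 sublinear0.
  rewrite -ler_pdivrMl//; apply: sublinear_cut_ge => t t0.
  rewrite ler_pdivrMl//.
  apply: le_trans (sublinear_cut_le _ _ _ (a * t) sp _) _.
    by rewrite mulr_ge0// ltW.
  by rewrite -scalerA -scalerDr mulrBr lerD ?(sp.2 _ _ (ltW a0))// mulrA.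
Qed.

Lemma sublinear_cut_le_id p y x : sublinear p -> sublinear_cut p y x <= p x.
Proof.
move=> sp; apply: le_trans (sublinear_cut_le _ _ _ 0 sp _) _ => //.
by rewrite scale0r addr0 mul0r subr0.
Qed.

Lemma sublinear_cut_opp p y : sublinear p -> sublinear_cut p y (- y) <= - p y.
Proof.
move=> sp; apply: le_trans (sublinear_cut_le _ _ _ 1 sp _) _ => //.
by rewrite scale1r addNr sublinear0// mul1r sub0r.
Qed.

(** Subadditivity at [(x + y) + (- y)] and oddness give the reverse inequality; a negative scalar
    [a] is handled as [- a] acting on [- x]. *)
Lemma sublinear_odd_linear f :
  sublinear f -> (forall x, f (- x) <= - f x) -> is_linear (f : V -> R^o).
Proof.
move=> sf odd.
have fN x : f (- x) = - f x.
  by have := odd x; have := sublinear_opp_ge _ x sf; lra.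
have fD x y : f (x + y) = f x + f y.
  have := sf.1 x y; have := sf.1 (x + y) (- y); rewrite addrK fN; lra.
move=> a x y; rewrite fD; congr (_ + _).
have [a0|/ltW a0] := leP 0 a; first exact: sublinear_scale.
have := sublinear_scale _ _ (- x) sf (_ : 0 <= - a).
rewrite oppr_ge0 => /(_ a0); rewrite scaleNr scalerN opprK fN mulrNN.
exact.
Qed.

(** Zorn's lemma supplies a minimal sublinear functional below [p], a nonempty chain being bounded
    below by its pointwise infimum. *)
Lemma sublinear_ge_linear p : sublinear p ->
  exists2 f, is_linear (f : V -> R^o) & forall x, f x <= p x.
Proof.
move=> sp.
pose S := {f : V -> R | sublinear f /\ forall x, f x <= p x}.
(* [r s t] puts [t] below [s], so a maximal element for [r] is a minimal functional. *)
pose r (s t : S) : bool := `[< forall x, sval t x <= sval s x >].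
have sub (s : S) : sublinear (sval s) by case: (svalP s).
have lep (s : S) x : sval s x <= p x by case: (svalP s).
have [| | | |s smin] := @Zorn S r.
- by move=> s; apply/asboolP => x.
- move=> s t u /asboolP st /asboolP tu; apply/asboolP => x.
  exact: le_trans (tu x) (st x).
- move=> [f fP] [g gP] /asboolP /= st /asboolP /= ts; apply: eq_exist.
  by apply/funext => x; apply/eqP; rewrite eq_le ts st.
- move=> A Atot; have [[s0 As0]|/set0P/negP/negPn/eqP A0] := pselect (A !=set0); last first.
    by exists (exist _ p (conj sp (fun x => lexx (p x)))) => s; rewrite A0.
  pose q x := inf [set sval s x | s in A].
  have qle s x : A s -> q x <= sval s x.
    move=> As; apply: ge_inf; last by exists s.
    exists (- p (- x)) => _ [t At <-].
    by have := sublinear_opp_ge _ x (sub t); have := lep t (- x); lra.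
  have qge x m : (forall s, A s -> m <= sval s x) -> m <= q x.
    move=> h; apply: lb_le_inf; first by exists (sval s0 x); exists s0.
    by move=> _ [s As <-]; exact: h.
  have sq : sublinear q.
    split=> [x y|a x].
      rewrite -lerBlDr; apply: (qge) => s As.
      rewrite lerBlDr -lerBlDl; apply: (qge) => t At; rewrite lerBlDl.
      (* Of two members of a chain, the smaller one serves at both [x] and [y]. *)
      have [/asboolP st|/asboolP ts] := Atot _ _ As At.
        have := qle _ (x + y) At; have := (sub t).1 x y; have := st x; lra.
      have := qle _ (x + y) As; have := (sub s).1 x y; have := ts y; lra.
    rewrite le_eqVlt => /orP[/eqP <-|a0].
      rewrite scale0r mul0r; have := qle _ 0 As0.
      by rewrite (sublinear0 _ (sub s0)).
    rewrite -ler_pdivrMl//; apply: (qge) => t At; rewrite ler_pdivrMl//.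
    by apply: le_trans (qle _ _ At) _; exact/(sub t).2/ltW.
  exists (exist _ q (conj sq (fun x => le_trans (qle _ x As0) (lep s0 x)))).
  by move=> s As; apply/asboolP => x; exact: qle.
exists (sval s); last exact: lep.
apply: sublinear_odd_linear (sub s) _ => y.
have le_cut x := sublinear_cut_le_id _ y x (sub s).
pose t : S := exist _ (sublinear_cut (sval s) y)
  (conj (sublinear_sublinear_cut _ y (sub s))
        (fun x => le_trans (le_cut x) (lep s x))).
(* By minimality the functional equals its own cut at [y]; turning only the right-hand side back to
   [s] leaves the bound on the cut at [- y]. *)
have <- : t = s by apply: smin; apply/asboolP.
rewrite [in leRHS](smin t); last exact/asboolP.
exact: sublinear_cut_opp.
Qed.

End HahnBanach.

(** * The dual norm and norming functionals *)

Section DualNorm.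
Context {R : realType} {X : normedModType R}.
Implicit Types (f g h : X -> R) (x y : X).

Lemma dual_bounded f : is_dual f -> exists M, forall x, `|f x| <= M * `|x|.
Proof.
move=> [lf cf].
pose F : {linear X -> R^o} := HB.pack (f : X -> R^o)
  (GRing.isLinear.Build R X R^o *:%R f lf).
have /linear_boundedP/pinfty_ex_gt0[M _ FM] : bounded_near F (nbhs 0).
  by apply/linear_bounded_continuous.
by exists M.
Qed.

Lemma bounded_is_dual f (K : R) : is_linear (f : X -> R^o) ->
  (forall x, `|f x| <= K * `|x|) -> is_dual f.
Proof.
move=> lf fK; split=> //.
pose F : {linear X -> R^o} := HB.pack (f : X -> R^o)
  (GRing.isLinear.Build R X R^o *:%R f lf).
apply: (@linear_bounded_continuous _ _ _ F).1.
apply/linear_boundedP; exists K; split=> [|r Kr x]; first exact: num_real.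
by apply: le_trans (fK x) _; apply: ler_wpM2r => //; exact: ltW.
Qed.

Lemma dual_linear f a x y : is_dual f -> f (a *: x + y) = a * f x + f y.
Proof. by move=> [lf _]; exact: lf. Qed.

Lemma dual0 f : is_dual f -> f 0 = 0.
Proof.
move=> df; have := dual_linear f 1 0 0 df; rewrite scaler0 addr0 mul1r; lra.
Qed.

Lemma dualZ f a x : is_dual f -> f (a *: x) = a * f x.
Proof.
by move=> df; have := dual_linear f a x 0 df; rewrite !addr0 (dual0 f df) addr0.
Qed.

Lemma dualB f x y : is_dual f -> f (x - y) = f x - f y.
Proof.
move=> df; have := dual_linear f (-1) y x df.
by rewrite scaleN1r mulN1r addrC => ->; rewrite addrC.
Qed.

Lemma dual_norm_has_sup f : is_dual f ->
  has_sup [set `|f x| | x in [set x : X | `|x| <= 1]].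
Proof.
move=> df; split; first by exists `|f 0|; exists 0 => //=; rewrite normr0.
have [M fM] := dual_bounded f df; exists `|M| => _ [x /= x1 <-].
apply: le_trans (fM x) _; apply: le_trans (ler_norm _) _.
by rewrite normrM normr_id ler_piMr.
Qed.

Lemma dual_norm_ge0 f : is_dual f -> 0 <= dual_norm f.
Proof.
move=> df; apply: le_trans (normr_ge0 (f 0)) _.
by apply: ub_le_sup (dual_norm_has_sup f df).2 _ _; exists 0 => //=; rewrite normr0.
Qed.

Lemma dual_norm_ub f x : is_dual f -> `|f x| <= dual_norm f * `|x|.
Proof.
move=> df; have [->|x0] := eqVneq x 0; first by rewrite dual0// !normr0 mulr0.
have nx0 : 0 < `|x| by rewrite normr_gt0.
rewrite -ler_pdivrMr//; apply: ub_le_sup (dual_norm_has_sup f df).2 _ _.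
exists (`|x|^-1 *: x); first by rewrite /= normrZ normfV normr_id mulVf ?normr_eq0.
by rewrite dualZ// normrM normfV normr_id mulrC.
Qed.

Lemma dual_norm_le f (K : R) : 0 <= K -> (forall x, `|f x| <= K * `|x|) ->
  dual_norm f <= K.
Proof.
move=> K0 fK; apply: ge_sup; first by exists `|f 0|; exists 0 => //=; rewrite normr0.
by move=> _ [x /= x1 <-]; apply: le_trans (fK x) _; rewrite ler_piMr.
Qed.

Lemma is_dual0 : is_dual (fun _ : X => 0 : R).
Proof.
apply: (bounded_is_dual _ 0) => [a x y|x]; last by rewrite normr0 mul0r.
by rewrite scaler0 addr0.
Qed.

Lemma dual_norm0 : dual_norm (fun _ : X => 0 : R) = 0.
Proof.
apply/eqP; rewrite eq_le (dual_norm_ge0 _ is_dual0) andbT.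
by apply: dual_norm_le => // x; rewrite normr0 mul0r.
Qed.

Lemma is_dual_lincomb (a b : R) f g : is_dual f -> is_dual g ->
  is_dual (fun x => a * f x + b * g x).
Proof.
move=> df dg; apply: (bounded_is_dual _ (`|a| * dual_norm f + `|b| * dual_norm g)).
  move=> k x y /=; rewrite !dual_linear//.
  by rewrite /GRing.scale /=; ring.
move=> x; apply: le_trans (ler_normD _ _) _; rewrite !normrM mulrDl -!mulrA.
by rewrite lerD// ler_wpM2l// dual_norm_ub.
Qed.

Lemma is_dualB f g : is_dual f -> is_dual g -> is_dual (fun x => f x - g x).
Proof.
move=> df dg; have := is_dual_lincomb 1 (-1) f g df dg.
by congr is_dual; apply/funext => x; rewrite mul1r mulN1r.
Qed.

Lemma dual_norm_triangle f g h : is_dual f -> is_dual g -> is_dual h ->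
  dual_norm (fun x => f x - h x) <=
  dual_norm (fun x => f x - g x) + dual_norm (fun x => g x - h x).
Proof.
move=> df dg dh; have dfg := is_dualB f g df dg; have dgh := is_dualB g h dg dh.
apply: dual_norm_le; first by rewrite addr_ge0 ?dual_norm_ge0.
move=> x; rewrite mulrDl; apply: le_trans (lerD (dual_norm_ub _ x dfg) (dual_norm_ub _ x dgh)).
by apply: le_trans (ler_normD _ _); rewrite addrA subrK.
Qed.

Lemma dual_normBC f g : dual_norm (fun x => f x - g x) = dual_norm (fun x => g x - f x).
Proof.
congr sup; apply/seteqP.
by split=> _ [x x1 <-]; exists x => //; rewrite distrC.
Qed.

Lemma dual_norm_leB f g : is_dual f -> is_dual g ->
  dual_norm f <= dual_norm g + dual_norm (fun x => f x - g x).
Proof.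
move=> df dg; have dfg := is_dualB f g df dg.
apply: dual_norm_le; first by rewrite addr_ge0 ?dual_norm_ge0.
move=> x; rewrite mulrDl; apply: le_trans (lerD (dual_norm_ub _ x dg) (dual_norm_ub _ x dfg)).
by apply: le_trans (ler_normD _ _); rewrite addrC subrK.
Qed.

(** A linear minorant of the cut of the norm at [x], rather than of the norm itself, satisfies
    [f (- x) <= - |x|], which forces equality at [x]. *)
Lemma norming_functional x :
  exists f, [/\ is_dual f, dual_norm f <= 1 & f x = `|x|].
Proof.
have sN : sublinear (fun y : X => `|y|).
  by split=> [y z|a y a0]; rewrite ?ler_normD// normrZ ger0_norm.
have [f lf fle] := sublinear_ge_linear _ (sublinear_sublinear_cut _ x sN).
have fleN y : f y <= `|y| := le_trans (fle y) (sublinear_cut_le_id _ x y sN).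
have fN y : f (- y) = - f y.
  have f0 : f 0 = 0.
    have := lf 1 0 0; rewrite scaler0 addr0 scale1r.
    by rewrite -[LHS]addr0 => /addrI <-.
  by have := lf (-1) y 0; rewrite !addr0 scaleN1r f0 addr0 scaleN1r.
have absf y : `|f y| <= `|y|.
  by rewrite ler_norml fleN andbT lerNl -fN -[leRHS]normrN fleN.
have df : is_dual f by apply: (bounded_is_dual f 1) => // y; rewrite mul1r.
exists f; split => //; first by apply: dual_norm_le => // y; rewrite mul1r.
apply/eqP; rewrite eq_le fleN/= -lerN2 -fN.
exact: le_trans (fle _) (sublinear_cut_opp _ x sN).
Qed.

End DualNorm.

(** * The Kadec-Klee inequality for real bounds *)

Section KadecKlee.
Context {R : realType} {X : normedModType R} (c : R).

(** Termwise bounds pass to the upper limits, so that [LKKstar] can be applied with real numbers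
    only. *)
Lemma LKKstar_bound (f : X -> R) (g : nat -> X -> R) (a b : R) :
  0 < c -> LKKstar c X -> is_dual f -> weakstar_null g ->
  (forall n, a <= dual_norm (g n)) ->
  (forall n, dual_norm (fun x => f x + g n x) <= b) ->
  dual_norm f + c * a <= b.
Proof.
move=> c0 lkk df g0 ga gb; have := lkk f g df g0.
have hb : (limn_esup (fun n => (dual_norm (fun x => f x + g n x))%:E) <= b%:E)%E.
  rewrite limn_esup_lim; apply: lime_le; first exact: is_cvg_esups.
  apply: nearW => n; apply: ge_ereal_sup => _ [k _ <-].
  by rewrite lee_fin.
have ha : (a%:E <= limn_esup (fun n => (dual_norm (g n))%:E))%E.
  rewrite limn_esup_lim; apply: lime_ge; first exact: is_cvg_esups.
  apply: nearW => n; apply: le_trans (_ : ((dual_norm (g n))%:E <= _)%E).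
    by rewrite lee_fin.
  by apply: ereal_sup_ubound; exists n => /=.
move=> h; rewrite -lee_fin EFinD EFinM.
apply: le_trans (le_trans h hb); apply: leeD2l.
by apply: lee_wpmul2l => //; rewrite lee_fin ltW.
Qed.

End KadecKlee.

(** * Grids and ultrafilter limits in the reals *)

Section RealSequences.
Context {R : realType}.

Lemma natSinv_lt (e : R) : 0 < e -> exists N : nat, forall n, (N <= n)%N -> n.+1%:R^-1 < e.
Proof.
move=> e0; have [N _ HN] := near_infty_natSinv_lt (PosNum e0).
by exists N => n Nn; exact: HN.
Qed.

(** Lets an integer code record a real up to the mesh [n.+1%:R^-1]. *)
Lemma floor_scaled_eq (n : nat) (u v : R) :
  Num.floor (n.+1%:R * u) = Num.floor (n.+1%:R * v) -> `|u - v| <= n.+1%:R^-1.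
Proof.
move=> uv; have := floor_itv (n.+1%:R * u); have := floor_itv (n.+1%:R * v).
rewrite uv intrD; set k := (Num.floor _)%:~R => /andP[k1 k2] /andP[k3 k4].
have n0 : 0 < n.+1%:R :> R by rewrite ltr0Sn.
rewrite -[leRHS]mul1r ler_pdivlMr// -[n.+1%:R]gtr0_norm// -normrM.
by rewrite ler_norml mulrC mulrBr; lra.
Qed.

(** Compactness of the segment gives a cluster point; an ultrafilter contains each set or its
    complement, so it converges to that point. *)
Lemma ultrafilter_cvg (U : set_system nat) (u : nat -> R) (B : R) :
  UltraFilter U -> (forall n, `|u n| <= B) -> exists l : R, u @ U --> l.
Proof.
move=> UU uB.
have [l [_ cl]] : `[- B, B]%classic `&` cluster (u @ U) !=set0.
  apply: (@segment_compact R (- B) B (u @ U) _).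
  rewrite nbhs_simpl; apply: (@filterE _ U) => n /=.
  by rewrite in_itv/= -ler_norml.
exists l => N lN.
have [//|UN] := in_ultra_setVsetC (u @^-1` N) UU.
have [y [/= nNy Ny]] := cl (~` N) N UN lN.
by [].
Qed.

End RealSequences.

(** * Norm separability of the dual ball and uniform splitting *)

Section DualDense.
Context {R : realType} {X : normedModType R} (c : R) (q : nat -> X).
Context (c01 : 0 < c <= 1) (lkk : LKKstar c X).
Context (q_dense : forall x (e : R), 0 < e -> exists i, `|x - q i| < e).

Definition dual_ball : set (X -> R) := [set f | is_dual f /\ dual_norm f <= 1].

Lemma dual_ballP f x : dual_ball f -> `|f x| <= `|x|.
Proof.
move=> [df f1]; apply: le_trans (dual_norm_ub _ x df) _.
by rewrite ler_piMl.
Qed.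

(** The uniform bound [K] spreads convergence from the dense sequence to all of [X]; each [q i] is
    controlled from index [i] on. *)
Lemma weakstar_null_dense (g : nat -> X -> R) (K : R) :
  (forall n, is_dual (g n)) -> (forall n, dual_norm (g n) <= K) ->
  (forall n i, (i <= n)%N -> `|g n (q i)| <= n.+1%:R^-1) -> weakstar_null g.
Proof.
move=> dg gK gq; split=> // x; apply/cvgrPdist_lt => /= e e0.
have K0 : 0 <= K := le_trans (dual_norm_ge0 _ (dg 0%N)) (gK 0%N).
have K1 : 0 < K + 1 by lra.
have [i xi] := q_dense x (e / 2 / (K + 1)) ltac:(rewrite !divr_gt0//).
have [N HN] := natSinv_lt (e / 2) ltac:(lra).
exists (maxn N i) => // n /=; rewrite geq_max => /andP[Nn ni].
rewrite sub0r normrN.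
have -> : g n x = g n (x - q i) + g n (q i) by rewrite dualB// subrK.
apply: le_lt_trans (ler_normD _ _) _.
have h1 : `|g n (x - q i)| <= e / 2.
  apply: le_trans (dual_norm_ub _ _ (dg n)) _.
  apply: le_trans (ler_wpM2r (normr_ge0 _) (gK n)) _.
  move: xi; rewrite ltr_pdivlMr// => xi.
  by apply: le_trans (ltW xi); rewrite mulrC ler_wpM2l// lerDl.
by rewrite (splitr e) ler_ltD// (le_lt_trans (gq n i ni))// HN.
Qed.

Lemma dual_ball_separable : exists e : nat -> X -> R,
  [/\ e 0%N = (fun=> 0), forall i, dual_ball (e i) &
   forall f (d : R), dual_ball f -> 0 < d -> exists i, dual_norm (fun x => f x - e i x) <= d].
Proof.
have /andP[c0 c1] := c01.
(* By [LKKstar], weak-star convergence together with convergence of the norms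
   implies norm convergence, so one functional per cell suffices. *)
pose cell n (f : X -> R) : nat * int * seq int :=
  (n, Num.floor (n.+1%:R * dual_norm f),
   [seq Num.floor (n.+1%:R * f (q i)) | i <- iota 0 n.+1]).
have ball0 : dual_ball (fun=> 0) by split; [exact: is_dual0|rewrite dual_norm0].
(* One functional of the ball for each code, in its cell when the cell is nonempty and 0
   otherwise. *)
have rep_ex (k : nat * int * seq int) : exists f, dual_ball f /\
    forall g, dual_ball g -> cell k.1.1 g = k -> cell k.1.1 f = k.
  have [[g [bg gk]]|h] := pselect (exists g, dual_ball g /\ cell k.1.1 g = k).
    by exists g.
  by exists (fun=> 0); split=> // g bg gk; exfalso; apply: h; exists g.
have [rep repP] := choice rep_ex.
(* Codes form a countable type; the shift by one reserves index 0 for the zero functional. *)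
pose e i := if i is i'.+1 then
  (if unpickle i' is Some k then rep k else fun=> 0) else (fun=> 0).
exists e; split => //.
  by case=> [|i] //=; case: unpickle => [k|] //; exact: (repP k).1.
move=> f d bf d0; apply: contrapT => /forallNP nd.
have [N HN] := natSinv_lt (c * d) ltac:(rewrite mulr_gt0//).
pose r n := rep (cell (N + n)%N f).
have br n : dual_ball (r n) by exact: (repP _).1.
have rcell n : cell (N + n)%N (r n) = cell (N + n)%N f.
  exact: ((repP (cell (N + n)%N f)).2 f bf erefl).
have rd n : d <= dual_norm (fun x => r n x - f x).
  rewrite dual_normBC ltW// ltNge; apply/negP => h.
  by apply: (nd (pickle (cell (N + n)%N f)).+1); rewrite /= pickleK.
have invle n : (N + n).+1%:R^-1 <= n.+1%:R^-1 :> R.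
  by rewrite lef_pV2 ?posrE ?ltr0Sn// ler_nat ltnS leq_addl.
(* The differences [r n - f] are weak-star null with norms at least [d], while the norm of [r n]
   exceeds that of [f] by at most the mesh. [N] was chosen with mesh below [c * d], so this bound is
   absurd. *)
have h : dual_norm f + c * d <= dual_norm f + N.+1%:R^-1.
  apply: (LKKstar_bound c f (fun n x => r n x - f x)) => //.
  - exact: bf.1.
  - apply: (weakstar_null_dense _ 2).
    + by move=> n; apply: is_dualB; [exact: (br n).1|exact: bf.1].
    + move=> n; apply: dual_norm_le => // x; apply: le_trans (ler_normB _ _) _.
      have := dual_ballP _ x (br n); have := dual_ballP _ x bf; lra.
    + move=> n i i_n; apply: le_trans (invle n); apply: floor_scaled_eq.
      have /eq_in_map := congr1 snd (rcell n).
      by apply; rewrite mem_iota add0n /= ltnS (leq_trans i_n)// leq_addl.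
  - move=> n; rewrite (_ : (fun x => _) = r n); last first.
      by apply/funext => x; rewrite addrC subrK.
    have : `|dual_norm (r n) - dual_norm f| <= (N + n).+1%:R^-1.
      by apply: floor_scaled_eq; exact: (congr1 (fun k => k.1.2) (rcell n)).
    have : (N + n).+1%:R^-1 <= N.+1%:R^-1 :> R.
      by rewrite lef_pV2 ?posrE ?ltr0Sn// ler_nat ltnS leq_addr.
    rewrite ler_norml; move: (N + n).+1%:R^-1 N.+1%:R^-1 => u v ? /andP[]; lra.
by move: (HN N (leqnn N)) h; move: N.+1%:R^-1 => u; lra.
Qed.

Context (e : nat -> X -> R) (e_ball : forall i, dual_ball (e i)).
Context (e_dense : forall f (d : R), dual_ball f -> 0 < d ->
  exists i, dual_norm (fun x => f x - e i x) <= d).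

(* A sequence of counterexamples would contradict [LKKstar] at its weak-star
   limit, which is taken along an ultrafilter. *)
Lemma uniform_splitting (n : nat) (eta : R) : 0 < eta ->
  exists M, forall f, dual_ball f -> exists i, [/\ (i <= M)%N,
    dual_norm (e i) + c * dual_norm (fun x => f x - e i x) <= dual_norm f + eta &
    forall l, (l < n)%N -> `|f (q l) - e i (q l)| <= eta].
Proof.
have /andP[c0 c1] := c01.
move=> eta0; apply: contrapT => /forallNP noM.
have /choice[F FP] M : exists f, dual_ball f /\ forall i, (i <= M)%N ->
    dual_norm (e i) + c * dual_norm (fun x => f x - e i x) <= dual_norm f + eta ->
    ~ forall l, (l < n)%N -> `|f (q l) - e i (q l)| <= eta.
  have /existsNP[f /not_implyP[bf /forallNP h]] := noM M.
  exists f; split=> // i iM h1 h2; apply: (h i); split=> //.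
have bF m : dual_ball (F m) by exact: (FP m).1.
have dF m : is_dual (F m) by exact: (bF m).1.
have [U [UU ooU]] := @ultraFilterLemma nat \oo _.
(* Pointwise limits along [U] provide the weak-star cluster point of the counterexamples. *)
have /choice[phi phiP] x : exists l : R, (fun m => F m x) @ U --> l.
  by apply: (ultrafilter_cvg U _ `|x|) => m; exact: dual_ballP.
have phi1 x : `|phi x| <= `|x|.
  have : (fun m => `|F m x|) @ U --> `|phi x| by apply: cvg_norm; exact: phiP.
  by move=> /cvgr_to_le; apply; apply: filterE => m; exact: dual_ballP.
have dphi : is_dual phi.
  apply: (bounded_is_dual _ 1) => [a x y|x]; last by rewrite mul1r.
  have h : (fun m => a * F m x + F m y) @ U --> a * phi x + phi y.
    by apply: cvgD; [apply: cvgMr; exact: phiP|exact: phiP].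
  apply: (cvg_unique (@Rhausdorff R) (phiP (a *: x + y))).
  by rewrite (_ : (fun m => F m (a *: x + y)) = (fun m => a * F m x + F m y))//;
    apply/funext => m; rewrite dual_linear.
have bphi : dual_ball phi.
  by split=> //; apply: dual_norm_le => // x; rewrite mul1r.
have dFphi m : is_dual (fun x => F m x - phi x) by exact: is_dualB.
have Fphi2 m : dual_norm (fun x => F m x - phi x) <= 2.
  apply: dual_norm_le => // x; apply: le_trans (ler_normB _ _) _.
  have := phi1 x; have := dual_ballP _ x (bF m); lra.
have [r rP] : exists l : R, (fun m => dual_norm (F m)) @ U --> l.
  apply: (ultrafilter_cvg U _ 1) => m.
  by rewrite ger0_norm ?dual_norm_ge0//; exact: (bF m).2.
have [s sP] : exists l : R, (fun m => dual_norm (fun x => F m x - phi x)) @ U --> l.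
  by apply: (ultrafilter_cvg U _ 2) => m; rewrite ger0_norm ?dual_norm_ge0.
pose Q := \sum_(l < n) `|q l|.
have Q0 : 0 <= Q by apply: sumr_ge0.
(* The norm inequality will cost at most [6 * d], using [c <= 1], and the values at the [q l] at
   most [d + d * Q]. *)
pose d := eta / (6 + Q).
have d0 : 0 < d by rewrite divr_gt0//; lra.
have dQ : d * (6 + Q) = eta by rewrite divfK//; lra.
have [i ei] := e_dense phi d bphi d0.
have near_q k j : U [set m | forall l, (l < j)%N -> `|F m (q l) - phi (q l)| <= k.+1%:R^-1].
  elim: j => [|j IH]; first by apply: filterE => m.
  have : U [set m | `|F m (q j) - phi (q j)| <= k.+1%:R^-1].
    by apply: (cvgr_distC_le _ _ (phiP (q j))); rewrite invr_gt0 ltr0Sn.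
  move: IH; apply: filterS2 => m h1 h2 l; rewrite ltnS leq_eqVlt => /orP[/eqP->//|].
  exact: h1.
(* [LKKstar] concerns sequences, so one is extracted from the ultrafilter. Requiring [i <= m] makes
   [e i] one of the functionals that [F m] excludes. *)
have /choice[N NP] k : exists m, [/\ (maxn k i <= m)%N,
    forall l, (l < k.+1)%N -> `|F m (q l) - phi (q l)| <= k.+1%:R^-1,
    `|dual_norm (F m) - r| <= d &
    `|dual_norm (fun x => F m x - phi x) - s| <= d].
  have h1 : U [set m | (maxn k i <= m)%N] by apply: ooU; exists (maxn k i).
  have h3 : U [set m | `|dual_norm (F m) - r| <= d].
    exact: (cvgr_distC_le _ _ rP).
  have h4 : U [set m | `|dual_norm (fun x => F m x - phi x) - s| <= d].
    exact: (cvgr_distC_le _ _ sP).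
  have [m [[[? ?] ?] ?]] :=
    filter_ex (filterI (filterI (filterI h1 (near_q k k.+1)) h3) h4).
  by exists m; split.
have key : dual_norm phi + c * (s - d) <= r + d.
  apply: (LKKstar_bound c phi (fun k x => F (N k) x - phi x)) => //.
  - apply: (weakstar_null_dense _ 2) => // k l lk.
    by have [_ h _ _] := NP k; exact: h.
  - by move=> k; have [_ _ _] := NP k; rewrite ler_norml => /andP[]; lra.
  - move=> k; rewrite (_ : (fun x => _) = F (N k)); last first.
      by apply/funext => x; rewrite addrC subrK.
    by have [_ _ + _] := NP k; rewrite ler_norml => /andP[]; lra.
have [K KP] := natSinv_lt d d0.
(* [K] makes the error at the points [q l] less than [d], and [n] ensures that all [l < n] are
   covered. *)
have [] := NP (maxn K n); set m := N _; rewrite geq_max => /andP[_ im] hq.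
rewrite !ler_norml => /andP[r1 r2] /andP[s1 s2].
apply: ((FP m).2 i im).
  have di := (e_ball i).1.
  have t1 : dual_norm (e i) <= dual_norm phi + d.
    by have := dual_norm_leB _ _ di dphi; rewrite dual_normBC; lra.
  have t2 : dual_norm (fun x => F m x - e i x) <= s + 2 * d.
    by have := dual_norm_triangle _ _ _ (dF m) dphi di; lra.
  have t3 : c * dual_norm (fun x => F m x - e i x) <= c * (s + 2 * d).
    by apply: ler_wpM2l => //; exact: ltW.
  have : 0 <= d * Q by rewrite mulr_ge0// ltW.
  nra.
move=> l ln.
have h1 : `|F m (q l) - phi (q l)| <= d.
  apply: le_trans (hq l _) _; first by rewrite ltnS (leq_trans (ltnW ln))// leq_maxr.
  by apply/ltW/KP; exact: leq_maxl.
have h2 : `|phi (q l) - e i (q l)| <= d * Q.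
  apply: le_trans (dual_norm_ub _ (q l) (is_dualB _ _ dphi (e_ball i).1)) _.
  apply: ler_pM => //.
    by rewrite dual_norm_ge0//; apply: is_dualB => //; exact: (e_ball i).1.
  rewrite /Q (bigD1 (Ordinal ln))//= lerDl; exact: sumr_ge0.
apply: le_trans (ler_distD (phi (q l)) _ _) _.
lra.
Qed.

End DualDense.

(** * A weak-star null norming sequence *)

Section NormingSequence.
Context {R : realType} {X : normedModType R} (c : R) (q : nat -> X).
Context (c01 : 0 < c <= 1) (lkk : LKKstar c X).
Context (q_dense : forall x (e : R), 0 < e -> exists i, `|x - q i| < e).

Lemma norming_weakstar_null (rho : R) : 0 < rho ->
  exists F : nat -> X -> R, [/\ weakstar_null F, forall k, dual_norm (F k) <= 1 &
    forall x (s : R), (forall k, `|F k x| <= s) -> `|x| <= (c^-1 + rho) * s].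
Proof.
have /andP[c0 c1] := c01; move=> rho0.
have [e [e0 e_ball e_dense]] := dual_ball_separable c q c01 lkk q_dense.
(* Each level loses [2 * tau n], once for the normalisation and once for the splitting error divided
   by [c]; the total over all levels is [rho]. *)
pose tau n : R := rho / 2 ^+ n.+2.
have tau0 n : 0 < tau n by rewrite divr_gt0// exprn_gt0.
(* Division by [c] leaves at most [tau n], and the factor [n.+1%:R] makes normalised differences
   tend to 0 on the dense sequence. *)
pose eta n : R := c * tau n / n.+1%:R.
have eta0 n : 0 < eta n by rewrite divr_gt0// mulr_gt0.
have eta_tau n : eta n / c <= tau n.
  rewrite /eta mulrAC [c * _]mulrC mulfK ?gt_eqF//.
  by rewrite ler_pdivrMr ?ltr0Sn// ler_peMr ?ler1n// ltW.
(* Level 0 contains only [e 0 = 0], so that the peeling ends with 0. *)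
have /choice[M MP] n : exists M, [/\ (n <= M)%N, n = 0%N -> M = 0%N &
    forall f, dual_ball f -> exists i, [/\ (i <= M)%N,
      dual_norm (e i) + c * dual_norm (fun x => f x - e i x) <= dual_norm f + eta n &
      forall l, (l < n)%N -> `|f (q l) - e i (q l)| <= eta n]].
  have [->|n0] := eqVneq n 0%N.
    exists 0%N; split=> // f bf; exists 0%N; split=> //.
    rewrite e0 dual_norm0 add0r (_ : (fun x => _) = f); last first.
      by apply/funext => x; rewrite subr0.
    have := dual_norm_ge0 f bf.1; have := ltW (eta0 0%N); nra.
  have [M MP] := uniform_splitting c q c01 lkk q_dense e e_ball e_dense n (eta n) (eta0 n).
  exists (maxn n M); split; first exact: leq_maxl.
    by move=> n1; rewrite n1 eqxx in n0.
  move=> f /MP[i [iM h1 h2]]; exists i; split=> //.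
  by rewrite (leq_trans iM)// leq_maxr.
pose D i j x : R := e i x - e j x.
have dD i j : is_dual (D i j) by apply: is_dualB; exact: (e_ball _).1.
(* The added [tau n] keeps the denominator positive even when [D i j] vanishes. *)
pose G n i j x : R := D i j x / (dual_norm (D i j) + tau n).
have den n i j : 0 < dual_norm (D i j) + tau n.
  by rewrite ltr_wpDl// dual_norm_ge0.
have dG n i j : is_dual (G n i j).
  have := is_dual_lincomb (dual_norm (D i j) + tau n)^-1 0 _ _ (dD i j) (dD i j).
  by congr is_dual; apply/funext => x; rewrite mul0r addr0 mulrC.
(* The finitely many pairs that can occur in peeling from level [n.+1] down to [n]. *)
pose small n i j := [&& (i <= M n.+1)%N, (j <= M n)%N &
  `[< forall l, (l < n)%N -> `|D i j (q l)| <= eta n >]].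
pose F k : X -> R := if pickle_inv k is Some (n, i, j) then
  (if small n i j then G n i j else fun=> 0) else fun=> 0.
have dF k : is_dual (F k).
  rewrite /F; case: pickle_inv => [[[n i] j]|]; last exact: is_dual0.
  by case: ifP => _; [exact: dG|exact: is_dual0].
have G1 n i j : dual_norm (G n i j) <= 1.
  apply: dual_norm_le => // x; rewrite /G normrM normfV (gtr0_norm (den n i j)) mul1r.
  rewrite ler_pdivrMr//; apply: le_trans (dual_norm_ub _ x (dD i j)) _.
  by rewrite mulrC ler_wpM2l// lerDl ltW.
have F1 k : dual_norm (F k) <= 1.
  rewrite /F; case: pickle_inv => [[[n i] j]|]; last by rewrite dual_norm0.
  by case: ifP => _; [exact: G1|rewrite dual_norm0].
have G_small n i j l : small n i j -> (l < n)%N -> `|G n i j (q l)| <= n.+1%:R^-1.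
  move=> /and3P[_ _ /asboolP Ds] ln.
  rewrite /G normrM normfV (gtr0_norm (den n i j)) ler_pdivrMr//.
  apply: le_trans (Ds l ln) _; rewrite /eta [leLHS]mulrC.
  rewrite ler_wpM2l ?invr_ge0//; apply: (@le_trans _ _ (tau n)).
    by rewrite ler_piMl// ltW.
  by rewrite lerDr dual_norm_ge0.
exists F; split => //.
  split=> // x; apply/cvgrPdist_le => /= d d0.
  have [l xl] := q_dense x (d / 2) ltac:(lra).
  have [N HN] := natSinv_lt (d / 2) ltac:(lra).
  (* Only the finitely many indices of levels below [n0] can exceed [d]. *)
  pose n0 := maxn N l.+1.
  pose B := (\max_(n < n0) \max_(i < (M n.+1).+1) \max_(j < (M n).+1)
    pickle (n : nat, i : nat, j : nat))%N.
  exists B.+1 => // k /= Bk; rewrite sub0r normrN /F.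
  case uk : (pickle_inv k) => [[[n i] j]|]; last by rewrite normr0 ltW.
  case: ifP => [sm|_]; last by rewrite normr0 ltW.
  have n0n : (n0 <= n)%N.
    rewrite leqNgt; apply/negP => nn0; have /and3P[iM jM _] := sm.
    move: Bk; rewrite ltnNge => /negP; apply.
    have -> : k = pickle (n, i, j).
      by have := @pickle_invK (nat * nat * nat)%type k; rewrite /oapp uk => ->.
    rewrite /B; apply: (bigop.bigmax_sup (Ordinal nn0)) => //=.
    apply: (bigop.bigmax_sup (Ordinal (iM : (i < (M n.+1).+1)%N))) => //=.
    by apply: (bigop.bigmax_sup (Ordinal (jM : (j < (M n).+1)%N))).
  move: n0n; rewrite geq_max => /andP[Nn ln].
  have -> : G n i j x = G n i j (x - q l) + G n i j (q l).
    by rewrite dualB// subrK.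
  apply: le_trans (ler_normD _ _) _; rewrite (splitr d) lerD//.
    apply: le_trans (dual_norm_ub _ _ (dG n i j)) _.
    by apply: le_trans (ltW xl); rewrite ler_piMl.
  by apply: le_trans (G_small _ _ _ _ sm ln) _; rewrite ltW// HN.
move=> x s Fs.
have s0 : 0 <= s := le_trans (normr_ge0 _) (Fs 0%N).
have Gs n i j : small n i j -> `|G n i j x| <= s.
  by move=> sm; have := Fs (pickle (n, i, j)); rewrite /F pickleK_inv sm.
(* Induction on the level: the splitting bounds [dual_norm (e j) / c + dual_norm (D i j)] by
   [dual_norm (e i) / c] plus an error, so the cost of each difference is paid by the drop in
   [dual_norm / c]. *)
have es n : forall i, (i <= M n)%N ->
    `|e i x| <= s * (dual_norm (e i) / c + rho * (1 - 1 / 2 ^+ n)).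
  elim: n => [|n IH] i iM.
    have [_ /(_ erefl) M0 _] := MP 0%N.
    move: iM; rewrite M0 leqn0 => /eqP ->.
    by rewrite e0 dual_norm0 normr0 expr0 divr1 subrr mulr0 mul0r addr0 mulr0.
  have [_ _ /(_ (e i) (e_ball i))[j [jM h1 h2]]] := MP n.
  have sm : small n i j by apply/and3P; split=> //; apply/asboolP.
  have := Gs _ _ _ sm.
  rewrite /G normrM normfV (gtr0_norm (den n i j)) ler_pdivrMr// => Ds.
  have -> : e i x = D i j x + e j x by rewrite subrK.
  apply: le_trans (ler_normD _ _) _; apply: le_trans (lerD Ds (IH j jM)) _.
  rewrite -mulrDr ler_wpM2l//.
  have h3 : dual_norm (e j) / c + dual_norm (D i j) <= dual_norm (e i) / c + eta n / c.
    rewrite -mulrDl ler_pdivlMr// mulrDl divfK ?gt_eqF//.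
    by rewrite [_ * c]mulrC.
  have h4 := eta_tau n.
  have h5 : rho * (1 - 1 / 2 ^+ n.+1) = rho * (1 - 1 / 2 ^+ n) + tau n * 2.
    by rewrite /tau !exprS; field; rewrite expf_neq0.
  lra.
(* Since [i <= M i], every [e i] belongs to level [i]. *)
have els i : `|e i x| <= s * (c^-1 + rho).
  have [iM _ _] := MP i; apply: le_trans (es i i iM) _.
  rewrite ler_wpM2l// lerD//.
    by rewrite ler_piMl ?invr_ge0 ?(ltW c0)//; exact: (e_ball i).2.
  by rewrite ler_piMr ?(ltW rho0)// gerBl divr_ge0// exprn_ge0.
(* The bound on all [e i] passes by density to a functional norming [x]. *)
have [f [df f1 fx]] := norming_functional x.
rewrite [leRHS]mulrC -[`|x|]fx; apply/ler_addgt0Pr => d d0.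
have x1 : 0 < `|x| + 1 by rewrite ltr_wpDl.
have [i fi] := e_dense f (d / (`|x| + 1)) (conj df f1) (divr_gt0 d0 x1).
have -> : f x = e i x + (f x - e i x) by rewrite addrC subrK.
apply: lerD; first exact: le_trans (ler_norm _) (els i).
apply: le_trans (ler_norm _) _.
apply: le_trans (dual_norm_ub _ x (is_dualB _ _ df (e_ball i).1)) _.
apply: le_trans (ler_wpM2r (normr_ge0 x) fi) _.
by rewrite mulrAC ler_pdivrMr// ler_wpM2l ?(ltW d0)// lerDl.
Qed.

End NormingSequence.

(** * Dense sequences from separability *)

Lemma separable_dense_seq (R : realType) (X : normedModType R) : separable X ->
  exists q : nat -> X, forall x (e : R), 0 < e -> exists i, `|x - q i| < e.
Proof.
move=> [D [/pfcard_geP Dc Dd]].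
have near x (e : R) : 0 < e -> exists2 y, D y & `|x - y| < e.
  move=> e0; have [||y [xy Dy]] := Dd (ball x e).
  - by exists x; exact: ballxx.
  - exact: ball_open.
  by exists y => //; move: xy; rewrite -ball_normE.
case: Dc => [D0|[q]].
  by have [y] := near 0 1 ltr01; rewrite D0.
exists q => x e e0; have [y Dy xy] := near x e e0.
by have [i _ qi] := @surj _ _ _ _ q y Dy; exists i; rewrite qi.
Qed.

(** * The sequence space and closedness of the range *)

Section Embedding.
Context {R : realType}.

Lemma c0_has_sup (u : nat -> R) : c0 u -> has_sup [set `|u n| | n in [set: nat]].
Proof.
move=> u0; split; first by exists `|u 0%N|; exists 0%N.
have /cvg_seq_bounded/pinfty_ex_gt0[M _ uM] : cvgn u by apply/cvg_ex; exists 0.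
by exists M => _ [n _ <-]; exact: uM.
Qed.

Lemma c0norm_ub (u : nat -> R) n : c0 u -> `|u n| <= c0norm u.
Proof. by move=> u0; apply: ub_le_sup (c0_has_sup u u0).2 _ _; exists n. Qed.

Lemma c0norm_le (u : nat -> R) (K : R) : (forall n, `|u n| <= K) -> c0norm u <= K.
Proof.
move=> uK; apply: ge_sup; first by exists `|u 0%N|; exists 0%N.
by move=> _ [n _ <-]; exact: uK.
Qed.

Lemma c0_lincomb (a b : R) (u v : nat -> R) : c0 u -> c0 v ->
  c0 (fun n => a * u n + b * v n).
Proof.
move=> u0 v0; rewrite /c0/= (_ : 0 = a * 0 + b * 0 :> R); last by rewrite !mulr0 addr0.
by apply: cvgD; apply: cvgMr.
Qed.

Lemma c0B (u v : nat -> R) : c0 u -> c0 v -> c0 (fun n => u n - v n).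
Proof.
move=> u0 v0; have := c0_lincomb 1 (-1) u v u0 v0.
by congr c0; apply/funext => n; rewrite mul1r mulN1r.
Qed.

(** The lower estimate makes approximate preimages of [u] a Cauchy sequence; by completeness it has
    a limit, whose image agrees with [u] in each coordinate. *)
Lemma range_closed_subspace_c0 (X : completeNormedModType R) (F : nat -> X -> R) (K : R) :
  weakstar_null F ->
  (forall x (s : R), (forall k, `|F k x| <= s) -> `|x| <= K * s) ->
  closed_subspace_c0 (range (fun x k => F k x)).
Proof.
move=> [dF F0] FK; split.
- by move=> _ [x _ <-]; exact: F0.
- by exists 0 => //; apply/funext => k; rewrite dual0.
- move=> a _ _ [x _ <-] [y _ <-]; exists (a *: x + y) => //.
  by apply/funext => k; rewrite dual_linear.
move=> u u0 uF.
have /choice[y yP] n : exists x, c0norm (fun k => u k - F k x) < n.+1%:R^-1.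
  have [|_ [x _ <-] h] := uF n.+1%:R^-1; first by rewrite invr_gt0.
  by exists x.
have yu n k : `|u k - F k (y n)| <= n.+1%:R^-1.
  apply: le_trans (ltW (yP n)).
  exact: (c0norm_ub (fun k => u k - F k (y n)) k (c0B _ _ u0 (F0 (y n)))).
have K0 : 0 <= K.
  have := FK 0 1; rewrite normr0 mulr1; apply=> k.
  by rewrite dual0// normr0.
have ycauchy n m : `|y n - y m| <= K * (n.+1%:R^-1 + m.+1%:R^-1).
  apply: FK => k; rewrite dualB//.
  apply: le_trans (ler_distD (u k) _ _) _; rewrite lerD//.
  by rewrite distrC.
have : cvg (y @ \oo).
  apply/cauchy_cvgP/cauchy_exP => /= e e0.
  have K1 : 0 < K + 1 by rewrite ltr_wpDl.
  have [N HN] := natSinv_lt (e / 2 / (K + 1)) ltac:(rewrite !divr_gt0//).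
  exists (y N), N => // n /= Nn; rewrite -ball_normE /=.
  apply: le_lt_trans (ycauchy N n) _.
  have := HN n Nn; have := HN N (leqnn N); rewrite !ltr_pdivlMr//.
  have : 0 < n.+1%:R^-1 :> R by rewrite invr_gt0.
  have : 0 < N.+1%:R^-1 :> R by rewrite invr_gt0.
  move: n.+1%:R^-1 N.+1%:R^-1 => a b; nra.
move=> /cvg_ex[x yx]; exists x => //; apply/funext => k.
have h1 : (fun n => F k (y n)) @ \oo --> F k x.
  by apply: continuous_cvg yx; exact: (dF k).2.
have h2 : (fun n => F k (y n)) @ \oo --> u k.
  apply/cvgrPdist_lt => /= e e0; have [N HN] := natSinv_lt e e0.
  by exists N => // n Nn; apply: le_lt_trans (yu n k) (HN n Nn).
exact: (cvg_unique (@Rhausdorff R) h1 h2).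
Qed.

End Embedding.

Theorem theorem2p4 (R : realType) (X : completeNormedModType R) (c : R) :
  0 < c <= 1 -> separable X -> LKKstar c X ->
  forall eps : R, 0 < eps ->
  exists E : set (nat -> R),
    closed_subspace_c0 E /\ (dBM X E <= (c ^-2 + eps)%:E)%E.
Proof.
move=> c01 /separable_dense_seq[q q_dense] lkk eps eps0.
have /andP[c0' c1] := c01.
have [F [wF F1 FK]] := norming_weakstar_null c q c01 lkk q_dense eps eps0.
have [dF F0] := wF.
pose T x k := F k x.
have KT x : `|x| <= (c^-1 + eps) * c0norm (T x).
  by apply: FK => k; exact: (c0norm_ub (T x) k (F0 x)).
have Tle x : c0norm (T x) <= `|x|.
  apply: c0norm_le => k; apply: le_trans (dual_norm_ub _ x (dF k)) _.
  by rewrite ler_piMl.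
have K0 : 0 <= c^-1 + eps by rewrite addr_ge0 ?invr_ge0// ltW.
exists (range T); split; first exact: range_closed_subspace_c0 wF FK.
have T0 : T 0 = (fun=> 0) by apply/funext => k; rewrite /T dual0.
have c0norm0 : c0norm (T 0) = 0.
  apply/eqP; rewrite eq_le; apply/andP; split.
    by apply: c0norm_le => k; rewrite T0 normr0.
  by apply: le_trans (c0norm_ub (T 0) 0%N (F0 0)).
have to1 : (opnorm_to_c0 T <= 1%:E)%E.
  by apply: ge_ereal_sup => _ [x /= x1 <-]; rewrite lee_fin (le_trans (Tle x)).
have invK : (opnorm_inv_c0 T <= (c^-1 + eps)%:E)%E.
  apply: ge_ereal_sup => _ [x /= x1 <-]; rewrite lee_fin (le_trans (KT x))//.
  by rewrite ler_piMr.
(* Nonnegativity of both factors, seen at the vector 0, allows the two bounds to be multiplied in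
   the extended reals. *)
have to0 : (0 <= opnorm_to_c0 T)%E.
  by apply: ereal_sup_ubound; exists 0; rewrite /= ?normr0 ?c0norm0.
have inv0 : (0 <= opnorm_inv_c0 T)%E.
  by apply: ereal_sup_ubound; exists 0; rewrite /= ?normr0 ?c0norm0.
apply: (@le_trans _ _ (opnorm_to_c0 T * opnorm_inv_c0 T)%E).
  apply: ereal_inf_lbound; exists T => //; split => //.
  - by move=> a x y; apply/funext => k; rewrite /T dual_linear.
  - move=> x y Txy; apply/eqP; rewrite -subr_eq0 -normr_eq0 eq_le normr_ge0 andbT.
    rewrite (le_trans (FK (x - y) 0 _)) ?mulr0// => k.
    by rewrite dualB// [F k x](congr1 (fun u => u k) Txy) subrr normr0.
  - exact: le_lt_trans to1 (ltry _).
  - exact: le_lt_trans invK (ltry _).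
(* The product is at most [c^-1 + eps], and [c^-1 <= c ^-2] because [c <= 1]. *)
apply: le_trans (lee_pmul to0 inv0 to1 invK) _.
rewrite mul1e lee_fin lerD2r -exprVn expr2 ler_peMr ?invr_ge0 ?(ltW c0')//.
by rewrite invf_ge1.
Qed.
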